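(* Let $E$ be an order continuous Banach lattice and $Y$ a Banach space. Then for every operator $T:E\to Y$ the following assertions are equivalent: (1) $T$ is disjoint weak Banach-Saks. (2) For each weakly null sequence $(x_n)$ of $E$ such that $x_n\overset{un}{\longrightarrow}0$, the sequence $(T(x_n))$ has a subsequence whose Cesàro sequence is norm convergent in $Y$. (3) For each weakly null sequence $(x_n)$ of $E$ such that $x_n\overset{uaw}{\longrightarrow}0$, the sequence $(T(x_n))$ has a subsequence whose Cesàro sequence is norm convergent in $Y$. (4) For each weakly null sequence $(x_n)$ of $E$ such that $x_n\overset{uo}{\longrightarrow}0$, the sequence $(T(x_n))$ has a subsequence whose Cesàro sequence is norm convergent in $Y$.
   Context: An operator is a bounded linear map. A sequence $(x_n)$ in a Banach lattice is disjoint if $|x_n|\wedge|x_m|=0$ for $n\ne m$. The Cesàro sequence of $(y_k)$ is $\left(\frac1m\sum_{k=1}^m y_k\right)_m$. An operator $T:E\to Y$ is disjoint weak Banach-Saks if for each disjoint weakly null sequence $(x_n)$ of $E$, $(T(x_n))$ has a subsequence whose Cesàro sequence is norm convergent in $Y$. A Banach lattice is order continuous if $x_\alpha\downarrow 0$ implies $\|x_\alpha\|\to0$. For a net $(x_\alpha)$ in $E$: $x_\alpha\overset{uo}{\longrightarrow}x$ if $|x_\alpha-x|\wedge u$ converges to $0$ in order for every $u\in E^+$; $x_\alpha\overset{un}{\longrightarrow}x$ if $|x_\alpha-x|\wedge u$ converges to $0$ in norm for every $u\in E^+$; $x_\alpha\overset{uaw}{\longrightarrow}x$ if $|x_\alpha-x|\wedge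 u$ converges to $0$ weakly for every $u\in E^+$. *)

(* Defs.v *)
From HB Require Import structures.
From mathcomp Require Import all_boot all_order all_algebra.
From mathcomp Require Import all_classical all_reals all_analysis.

Set Implicit Arguments.
Unset Strict Implicit.
Unset Printing Implicit Defensive.

Import Order.TTheory GRing.Theory Num.Theory.
Import numFieldNormedType.Exports.

Local Open Scope classical_set_scope.
Local Open Scope ring_scope.

(* A structure inheriting from both CompleteNormedModule and Order.Lattice is
   refused by Hierarchy Builder (missing joins with Num.RealDomain).  The lattice
   operations are therefore raw fields of the mixin, from which the
   Order.Lattice instance is built right after the structure. *)
HB.mixin Record isBanachLattice (R : realType) E
    of CompleteNormedModule R E := {
  bl_le : rel E ;
  bl_meet : E -> E -> E ;
  bl_join : E -> E -> E ;
  bl_le_refl : reflexive bl_le ;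
  bl_le_anti : antisymmetric bl_le ;
  bl_le_trans : transitive bl_le ;
  bl_lexI : forall x y z, bl_le x (bl_meet y z) = bl_le x y && bl_le x z ;
  bl_leUx : forall x y z, bl_le (bl_join x y) z = bl_le x z && bl_le y z ;
  bl_leD2r : forall x y z : E, bl_le x y -> bl_le (x + z) (y + z) ;
  bl_leZ : forall (a : R) (x y : E), 0 <= a -> bl_le x y ->
    bl_le (a *: x) (a *: y) ;
  bl_le_norm : forall x y : E,
    bl_le (bl_join x (- x)) (bl_join y (- y)) -> `|x| <= `|y|
}.

#[short(type="banachLatticeType")]
HB.structure Definition BanachLattice (R : realType) :=
  { E of isBanachLattice R E & CompleteNormedModule R E }.

#[non_forgetful_inheritance]
HB.instance Definition _ (R : realType) (E : banachLatticeType R) :=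
  Order.Le_isPOrder.Build ring_display (BanachLattice.sort E)
    bl_le_refl bl_le_anti bl_le_trans.
#[non_forgetful_inheritance]
HB.instance Definition _ (R : realType) (E : banachLatticeType R) :=
  Order.POrder_isMeetSemilattice.Build ring_display (BanachLattice.sort E)
    bl_lexI.
#[non_forgetful_inheritance]
HB.instance Definition _ (R : realType) (E : banachLatticeType R) :=
  Order.POrder_isJoinSemilattice.Build ring_display (BanachLattice.sort E)
    bl_leUx.

Section BanachLatticeNotions.
Context {R : realType} {E : banachLatticeType R}.
Implicit Types (x y u : E).

Definition lattice_abs x : E := Order.join x (- x).

Definition disjoint_seq (x : E ^nat) :=
  forall n m, n != m -> Order.meet (lattice_abs (x n)) (lattice_abs (x m)) = 0.

End BanachLatticeNotions.

Section Nets.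

Definition directed (J : Type) (r : J -> J -> Prop) :=
  [/\ inhabited J, (forall a, r a a),
      (forall a b c, r a b -> r b c -> r a c) &
      forall a b, exists2 c, r a c & r b c].

(* The filter of the tails of a net indexed by J. *)
Definition tails (J : Type) (r : J -> J -> Prop) : set_system J :=
  filter_from setT r.

Context {R : realType} {E : banachLatticeType R}.

Definition decreasing_to0 (J : Type) (r : J -> J -> Prop) (y : J -> E) :=
  [/\ directed r, (forall a b, r a b -> y b <= y a) & infimums (range y) 0].

End Nets.

Definition order_continuous (R : realType) (E : banachLatticeType R) :=
  forall (J : Type) (r : J -> J -> Prop) (y : J -> E),
    decreasing_to0 r y -> `|y a| @[a --> tails r] --> (0 : R).

Definition bounded_operator (R : realType) (V W : normedModType R)
    (T : V -> W) :=
  exists C : R, forall v, `|T v| <= C * `|v|.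

(* All modes of convergence are along a filter F on the index set: nets are
   covered by F = tails r, sequences by F = \oo. *)
Section Convergences.
Context {R : realType} {I : Type} (F : set_system I).

Definition weak_cvg (V : normedModType R) (x : I -> V) (l : V) :=
  forall f : {linear V -> R^o}, bounded_operator f ->
    f (x i) @[i --> F] --> (f l : R^o).

Context {E : banachLatticeType R}.
Implicit Types (x : I -> E) (l : E).

(* The dominating net y may have an index set J of its own. *)
Definition order_cvg x l :=
  exists (J : Type) (r : J -> J -> Prop) (y : J -> E),
    decreasing_to0 r y /\
    forall b, \forall i \near F, lattice_abs (x i - l) <= y b.

Definition uo_cvg x l := forall u : E, 0 <= u ->
  order_cvg (fun i => Order.meet (lattice_abs (x i - l)) u) 0.

Definition un_cvg x l := forall u : E, 0 <= u ->
  Order.meet (lattice_abs (x i - l)) u @[i --> F] --> (0 : E).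

Definition uaw_cvg x l := forall u : E, 0 <= u ->
  weak_cvg (fun i => Order.meet (lattice_abs (x i - l)) u) 0.

End Convergences.

Definition cesaro_seq (R : realType) (V : normedModType R) (y : V ^nat) :
    V ^nat :=
  [sequence m.+1%:R^-1 *: \sum_(k < m.+1) y k]_m.

Definition has_cesaro_cvg_subseq (R : realType) (V : normedModType R)
    (y : V ^nat) :=
  exists2 phi : nat -> nat, increasing_seq phi & cvgn (cesaro_seq (y \o phi)).

Definition disjoint_weak_Banach_Saks (R : realType) (E : banachLatticeType R)
    (Y : normedModType R) (T : E -> Y) :=
  forall x : E ^nat, disjoint_seq x -> weak_cvg \oo x 0 ->
    has_cesaro_cvg_subseq (T \o x).

(* Main.v *)
Require Import Defs.
From HB Require Import structures.
From mathcomp Require Import all_boot all_order all_algebra.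
From mathcomp Require Import all_classical all_reals all_analysis.
From mathcomp Require Import ring lra.

Set Implicit Arguments.
Unset Strict Implicit.
Unset Printing Implicit Defensive.

Import Order.TTheory GRing.Theory Num.Theory.
Import numFieldNormedType.Exports.

Local Open Scope classical_set_scope.
Local Open Scope ring_scope.

(** Un-null and uaw-null sequences are the same in an order continuous Banach
    lattice, and un-null sequences are, up to a subsequence and a norm-null
    perturbation, disjoint. This gives the four assertions in a cycle.

    - (1) implies (2): a Kadec-Pelczynski argument
      ([un_cvg0_almost_disjoint]) extracts from an un-null sequence a
      subsequence [x (phi n)] and a disjoint sequence [d] with
      [x (phi n) - d n] norm-null. To get [d], the parts of [|x (phi k)|] that
      overlap the other terms are summed into a vector [v k] of small norm, and
      [x (phi k)] is reduced by its truncation to [[- v k, v k]]. If [x] is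
      weakly null so is [d], and a norm-null perturbation does not affect the
      convergence of Cesaro means.

    - (2) implies (3): uaw-convergence implies un-convergence
      ([uaw_cvg_un_cvg]), that is, a weakly null sequence [y] in an order
      interval [[0, u]] is norm-null ([order_bounded_weakly_null_cvg0]).
      Otherwise one may assume [||y n|| >= e > 0]. The Hahn-Banach theorem
      provides positive functionals [f n] of norm at most 1 with
      [f n (y n) = ||y n||]; after a diagonal extraction [f i (y k) <= 2^-k] for
      [i < k]. The suprema [z k] of the truncated sums
      [(y k + ... + y (m-1)) /\ u] over [m] exist as norm limits by order
      continuity, decrease in norm to some [t], and [f i t = 0] for all [i].
      Hence
      [e <= f k (y k) <= f k (z k) = f k (z k - t) <= ||z k - t||], which
      tends to 0: a contradiction.

    - (3) implies (4): order continuity turns uo-convergence into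
      un-convergence, and bounded functionals turn un-convergence into
      uaw-convergence.

    - (4) implies (1): disjoint sequences are uo-null
      ([disjoint_seq_uo_cvg0]), because the partial sums of a disjoint
      positive sequence bounded by [u] increase and are bounded by [u], hence
      converge. *)

(** * Vector lattices and the lattice norm *)

Section VectorLattice.
Context {R : realType} {E : banachLatticeType R}.
Implicit Types (x y z u v w : E).

Local Notation "x `&` y" := (Order.meet x y) : ring_scope.
Local Notation "x `|` y" := (Order.join x y) : ring_scope.
Local Notation abs := (@lattice_abs R E).

Lemma bl_lerD2r z x y : (x + z <= y + z) = (x <= y).
Proof.
apply/idP/idP => [xy|]; last exact: bl_leD2r.
by rewrite -[x](addrK z) -[y](addrK z); exact: bl_leD2r.
Qed.

Lemma bl_lerD2l z x y : (z + x <= z + y) = (x <= y).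
Proof. by rewrite ![z + _]addrC bl_lerD2r. Qed.

Lemma bl_lerD x y z w : x <= y -> z <= w -> x + z <= y + w.
Proof.
by move=> xy zw; apply: (@le_trans _ _ (y + z)); rewrite ?bl_lerD2r ?bl_lerD2l.
Qed.

Lemma bl_lerBlDr x y z : (x - y <= z) = (x <= z + y).
Proof. by rewrite -(bl_lerD2r y (x - y)) subrK. Qed.

Lemma bl_lerBrDr x y z : (x <= y - z) = (x + z <= y).
Proof. by rewrite -(bl_lerD2r z x) subrK. Qed.

Lemma bl_subr_ge0 x y : (0 <= y - x) = (x <= y).
Proof. by rewrite bl_lerBrDr add0r. Qed.

Lemma bl_lerN2 x y : (- x <= - y) = (y <= x).
Proof. by rewrite -[LHS]bl_subr_ge0 opprK addrC bl_subr_ge0. Qed.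

Lemma bl_oppr_le0 x : (- x <= 0) = (0 <= x).
Proof. by rewrite -{1}oppr0 bl_lerN2. Qed.

Lemma bl_addr_ge0 x y : 0 <= x -> 0 <= y -> 0 <= x + y.
Proof. by move=> x0 y0; rewrite -[0]addr0 bl_lerD. Qed.

Lemma bl_lerDl x y : 0 <= y -> x <= x + y.
Proof. by move=> y0; rewrite -{1}[x]addr0 bl_lerD2l. Qed.

Lemma bl_sumr_ge0 (I : Type) (r : seq I) (P : pred I) (F : I -> E) :
  (forall i, P i -> 0 <= F i) -> 0 <= \sum_(i <- r | P i) F i.
Proof.
move=> F0; elim/big_rec: _ => // i x Pi x0.
exact: bl_addr_ge0 (F0 _ Pi) x0.
Qed.

Lemma bl_lerZ (a : R) x y : 0 <= a -> x <= y -> a *: x <= a *: y.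
Proof. exact: bl_leZ. Qed.

Lemma bl_half_ge0 x : 0 <= x + x -> 0 <= x.
Proof.
move=> x0; have -> : x = 2^-1 *: (x + x).
  by rewrite -mulr2n -(scaler_nat 2 x) scalerA mulVf ?scale1r.
rewrite -(scaler0 _ (2^-1 : R)); apply: bl_lerZ => //.
Qed.

Lemma bl_meetD x y z : (x `&` y) + z = (x + z) `&` (y + z).
Proof.
apply/eqP; rewrite eq_le lexI !bl_lerD2r leIl leIr/=.
by rewrite -bl_lerBlDr lexI !bl_lerBlDr leIl leIr.
Qed.

Lemma lattice_abs_ler x : x <= abs x. Proof. exact: leUl. Qed.
Lemma lattice_abs_lerN x : - x <= abs x. Proof. exact: leUr. Qed.

Lemma lattice_abs_le x y : (abs x <= y) = (x <= y) && (- x <= y).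
Proof. exact: leUx. Qed.

Lemma lattice_abs_ge0 x : 0 <= abs x.
Proof.
apply: bl_half_ge0; rewrite -(subrr x).
exact: bl_lerD (lattice_abs_ler x) (lattice_abs_lerN x).
Qed.

Lemma ge0_lattice_abs x : 0 <= x -> abs x = x.
Proof.
move=> x0; apply/eqP; rewrite eq_le lattice_abs_ler lattice_abs_le lexx/= andbT.
by apply: (le_trans _ x0); rewrite bl_oppr_le0.
Qed.

Lemma lattice_abs_norm x y : abs x <= abs y -> `|x| <= `|y|.
Proof. exact: bl_le_norm. Qed.

Lemma norm_lattice_abs x : `|abs x| = `|x|.
Proof.
apply/eqP; rewrite eq_le; apply/andP; split; apply: lattice_abs_norm;
  by rewrite (ge0_lattice_abs (lattice_abs_ge0 x)).
Qed.

Lemma lattice_abs_ler_norm x y : abs x <= y -> `|x| <= `|y|.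
Proof.
by move=> xy; apply: lattice_abs_norm; apply: le_trans xy (lattice_abs_ler y).
Qed.

Lemma bl_ler_norm x y : 0 <= x -> x <= y -> `|x| <= `|y|.
Proof.
by move=> x0 xy; apply: lattice_abs_ler_norm; rewrite ge0_lattice_abs.
Qed.

Lemma norm_pospart x : `|x `|` 0| <= `|x|.
Proof.
apply: lattice_abs_norm; rewrite ge0_lattice_abs ?leUr//.
by rewrite leUx lattice_abs_ler lattice_abs_ge0.
Qed.

Lemma norm_pospart_eq0 x : `|x `|` 0| = 0 -> x <= 0.
Proof. by move=> /normr0_eq0 <-; exact: leUl. Qed.

(** The positive cone is norm closed, since [x |-> x^+] does not increase the
    norm: if [a <= x i] then [(a - l)^+ <= |x i - l|]. *)
Lemma bl_closed_ge (I : Type) (F : set_system I) (FF : ProperFilter F)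
    (x : I -> E) (a l : E) :
  x @ F --> l -> (\forall i \near F, a <= x i) -> a <= l.
Proof.
move=> xl ax; rewrite -[a](subrK l) -[leRHS]add0r bl_lerD2r.
apply: norm_pospart_eq0; apply/eqP; rewrite eq_le normr_ge0 andbT.
apply/ler_addgt0Pr => e e0; rewrite add0r.
have /cvgrPdist_le/(_ _ e0) xe := xl.
have [n [an le]] := @filter_ex _ F _ _ (filterI ax xe).
apply: le_trans le; rewrite distrC -[leRHS]norm_lattice_abs.
apply: bl_ler_norm; first exact: leUr.
rewrite leUx lattice_abs_ge0 andbT; apply: le_trans (lattice_abs_ler _).
by rewrite bl_lerD2r.
Qed.

Lemma bl_closed_le (I : Type) (F : set_system I) (FF : ProperFilter F)
    (x : I -> E) (b l : E) :
  x @ F --> l -> (\forall i \near F, x i <= b) -> l <= b.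
Proof.
move=> xl xb; rewrite -bl_lerN2.
apply: (@bl_closed_ge _ F _ (fun i => - x i)); first exact: cvgN.
by apply: filterS xb => i; rewrite bl_lerN2.
Qed.

(** The meet with a fixed positive element is subadditive on the positive
    cone; in particular disjointness from it is preserved by sums. *)
Lemma bl_meetDl x y z : 0 <= x -> 0 <= y -> 0 <= z ->
  (x + y) `&` z <= (x `&` z) + (y `&` z).
Proof.
move=> x0 y0 z0; set w := (x + y) `&` z.
have wx : w - y <= x `&` z.
  rewrite lexI !bl_lerBlDr leIl/=; apply: (@le_trans _ _ z); first exact: leIr.
  exact: bl_lerDl.
have xz0 : 0 <= x `&` z by rewrite lexI x0.
rewrite addrC -bl_lerBlDr lexI !bl_lerBlDr; apply/andP; split.
  by rewrite addrC -bl_lerBlDr.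
by apply: (@le_trans _ _ z); [exact: leIr|exact: bl_lerDl].
Qed.

Lemma bl_meetI0D_le x y u : x `&` y = 0 -> x <= u -> y <= u -> x + y <= u.
Proof.
move=> xy0 xu yu; rewrite -bl_subr_ge0.
(* Translating [x /\ y = 0] by [u - x - y] gives
   [(u - y) /\ (u - x) = u - x - y]. *)
have : x `&` y + (u - x - y) <= 0 + (u - x - y) by rewrite xy0.
rewrite bl_meetD.
have -> : x + (u - x - y) = u - y by rewrite addrA addrA [x + u]addrC addrK.
have -> : y + (u - x - y) = u - x by rewrite addrC subrK.
rewrite add0r opprD addrA; apply: le_trans.
by rewrite lexI !bl_subr_ge0 xu yu.
Qed.

End VectorLattice.

(** * The Hahn-Banach theorem for sublinear functionals *)

Section HahnBanach.
Context {R : realType} {V : lmodType R}.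
Implicit Types (p q : V -> R) (x y v : V).

(** Real sublinear functionals. Positive homogeneity is only required as
    an inequality for positive scalars; the reverse inequality and the value
    at 0 follow. *)
Definition sublinear q :=
  (forall x y, q (x + y) <= q x + q y) /\
  (forall (a : R) x, 0 < a -> q (a *: x) <= a * q x).

Lemma sublinearZ q : sublinear q ->
  forall (a : R) x, 0 < a -> q (a *: x) = a * q x.
Proof.
move=> [_ qZ] a x a0; apply/eqP; rewrite eq_le qZ//=.
rewrite -ler_pdivlMl// (le_trans _ (qZ _ _ _)) ?invr_gt0//.
by rewrite scalerA mulVf ?gt_eqF// scale1r.
Qed.

Lemma sublinear0 q : sublinear q -> q 0 = 0.
Proof.
move=> qs; have := sublinearZ qs 0 (ltr0Sn R 1).
by rewrite scaler0; lra.
Qed.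

Lemma sublinearZ0 q : sublinear q ->
  forall (a : R) x, 0 <= a -> q (a *: x) = a * q x.
Proof.
move=> qs a x; rewrite le_eqVlt => /predU1P[<-|]; last exact: sublinearZ.
by rewrite scale0r mul0r sublinear0.
Qed.

Lemma sublinearN q x : sublinear q -> - q (- x) <= q x.
Proof.
move=> qs; have := qs.1 x (- x).
by rewrite subrr (sublinear0 qs); lra.
Qed.

Lemma inf_le_of_lbound (A : set R) (m a : R) :
  lbound A m -> A a -> inf A <= a.
Proof. by move=> Am Aa; apply: ge_inf => //; exists m. Qed.

(** A pointwise infimum of a family of functions is sublinear if the family is
    bounded below and satisfies the sublinearity inequalities up to passing to
    another member. *)
Lemma sublinear_inf p (I : Type) (A : set I) (q : I -> V -> R) :
  A !=set0 ->
  (forall i x, A i -> - p (- x) <= q i x) ->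
  (forall i j x y, A i -> A j ->
    exists2 k, A k & q k (x + y) <= q i x + q j y) ->
  (forall i (a : R) x, A i -> 0 < a ->
    exists2 k, A k & q k (a *: x) <= a * q i x) ->
  sublinear (fun x => inf [set q i x | i in A]).
Proof.
move=> [i0 Ai0] qp qD qZ.
have lbA x : lbound [set q i x | i in A] (- p (- x)).
  by move=> _ [i Ai <-]; exact: qp.
have neA x : [set q i x | i in A] !=set0 by exists (q i0 x), i0.
split=> [x y|a x a0].
  rewrite -lerBlDr; apply: lb_le_inf => // _ [i Ai <-].
  rewrite lerBlDr [leRHS]addrC -lerBlDr; apply: lb_le_inf => // _ [j Aj <-].
  rewrite lerBlDr [leRHS]addrC; have [k Ak] := qD _ _ x y Ai Aj.
  by apply: le_trans; apply: (inf_le_of_lbound (lbA _)); exists k.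
rewrite -ler_pdivrMl//; apply: lb_le_inf => // _ [i Ai <-].
rewrite ler_pdivrMl//; have [k Ak] := qZ _ _ x Ai a0.
by apply: le_trans; apply: (inf_le_of_lbound (lbA _)); exists k.
Qed.

(** The sublinear functional [x |-> inf_(t >= 0) (q (x + t v) - t q v)]. It is
    below [q] (take [t = 0]), and its sum with [q v] is at most [q (x + v)]
    (take [t = 1]). *)
Definition sublinear_push q v x : R :=
  inf [set q (x + t *: v) - t * q v | t in [set t : R | 0 <= t]].

Section Push.
Context (q : V -> R) (v : V) (qs : sublinear q).

Let lb (t : R) x : 0 <= t -> - q (- x) <= q (x + t *: v) - t * q v.
Proof.
move=> t0; have := qs.1 (x + t *: v) (- x).
by rewrite addrAC subrr add0r (sublinearZ0 qs)//; lra.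
Qed.

Lemma sublinear_push_le (t : R) x : 0 <= t ->
  sublinear_push q v x <= q (x + t *: v) - t * q v.
Proof.
move=> t0; apply: (@inf_le_of_lbound _ (- q (- x))); last by exists t.
by move=> _ [s /= s0 <-]; exact: lb.
Qed.

Lemma sublinear_push_sublinear : sublinear (sublinear_push q v).
Proof.
apply: (@sublinear_inf q _ _ (fun t x => q (x + t *: v) - t * q v)).
- by exists 0 => /=.
- by move=> t x; exact: lb.
- move=> s t x y /= s0 t0; exists (s + t); first exact: addr_ge0.
  have := qs.1 (x + s *: v) (y + t *: v).
  by rewrite addrACA -scalerDl; lra.
- move=> t a x /= t0 a0; exists (a * t); first by rewrite mulr_ge0// ltW.
  by rewrite -scalerA -scalerDr (sublinearZ qs)//; lra.
Qed.

End Push.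

(** Zorn's lemma: the infimum of a chain of sublinear functionals below [p] is
    sublinear, being bounded below at [x] by [- p (- x)]. *)
Lemma exists_minimal_sublinear p : sublinear p ->
  exists q, [/\ sublinear q, (forall x, q x <= p x) &
    forall r, sublinear r -> (forall x, r x <= q x) -> forall x, q x <= r x].
Proof.
move=> ps.
pose T := {q : V -> R | sublinear q /\ forall x, q x <= p x}.
pose le (q r : T) := `[< forall x, sval r x <= sval q x >].
pose p0 : T := exist (fun q : V -> R => sublinear q /\ forall x, q x <= p x)
  p (conj ps (fun x => lexx _)).
have [||A Atot|[q [qs qp]] qmin] := @ZL_preorder T p0 le.
- by move=> q; apply/asboolP.
- move=> r q s /asboolP rq /asboolP qs; apply/asboolP => x.
  exact: le_trans (qs x) (rq x).
- have [->|/set0P[q0 Aq0]] := eqVneq A set0.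
    by exists p0 => ? [].
  have ms : sublinear (fun x => inf [set sval q x | q in A]).
    apply: (@sublinear_inf p).
    + by exists q0.
    + move=> q x _; apply: le_trans (sublinearN x (svalP q).1).
      by rewrite lerN2; exact: (svalP q).2.
    + move=> q r x y Aq Ar; have [/asboolP qr|/asboolP rq] := Atot _ _ Aq Ar.
        exists r => //; apply: le_trans ((svalP r).1.1 _ _) _.
        by rewrite lerD2r.
      exists q => //; apply: le_trans ((svalP q).1.1 _ _) _.
      by rewrite lerD2l.
    + by move=> q a x Aq a0; exists q => //; exact: (svalP q).1.2.
  have mle (q : T) x : A q -> inf [set sval q x | q in A] <= sval q x.
    move=> Aq; apply: (@inf_le_of_lbound _ (- p (- x))); last by exists q.
    move=> _ [r Ar <-]; apply: le_trans (sublinearN x (svalP r).1).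
    by rewrite lerN2; exact: (svalP r).2.
  have mp x : inf [set sval q x | q in A] <= p x.
    exact: le_trans (mle q0 x Aq0) ((svalP q0).2 x).
  pose m : T := exist (fun q : V -> R => sublinear q /\ forall x, q x <= p x)
    (fun x => inf [set sval q x | q in A]) (conj ms mp).
  by exists m => q Aq; apply/asboolP => x; exact: mle.
exists q; split=> // r rs rq x.
have rp y : r y <= p y by exact: le_trans (rq y) (qp y).
have := qmin (exist _ r (conj rs rp)).
by rewrite /le => /(_ _)/asboolP; apply; apply/asboolP.
Qed.

(** By minimality [q] is below [sublinear_push q y] for every [y], which at
    [t = 1] reads [q x + q y <= q (x + y)]. *)
Lemma minimal_sublinear_linear q : sublinear q ->
    (forall r, sublinear r -> (forall x, r x <= q x) -> forall x, q x <= r x) ->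
  linear (q : V -> R^o).
Proof.
move=> qs qmin.
have qD x y : q (x + y) = q x + q y.
  apply/eqP; rewrite eq_le qs.1/= -lerBrDr.
  have le1 z : sublinear_push q y z <= q z.
    have := sublinear_push_le y qs z (lexx 0).
    by rewrite scale0r addr0 mul0r subr0.
  apply: le_trans (qmin _ (sublinear_push_sublinear y qs) le1 x) _.
  by have := sublinear_push_le y qs x ler01; rewrite scale1r mul1r.
have qN x : q (- x) = - q x.
  by apply/eqP; rewrite -addr_eq0 -qD addrC subrr (sublinear0 qs).
have qZ a x : q (a *: x) = a * q x.
  have [a0|a0] := leP 0 a; first exact: sublinearZ0.
  by rewrite -[a]opprK scaleNr qN (sublinearZ qs) ?oppr_gt0// !mulNr.
by move=> a x y; rewrite qD qZ.
Qed.

Theorem hahn_banach_sublinear p v : sublinear p ->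
  exists f : {linear V -> R^o}, (forall x, f x <= p x) /\ f v = p v.
Proof.
move=> ps.
(* Starting from [sublinear_push p v] rather than [p] forces
   [f (- v) <= - p v]. *)
have [q [qs qp qmin]] :=
  exists_minimal_sublinear (sublinear_push_sublinear v ps).
have ql := minimal_sublinear_linear qs qmin.
pose F := GRing.isLinear.Build _ _ _ _ (q : V -> R^o) ql.
pose f : {linear V -> R^o} := HB.pack (q : V -> R^o) F.
have fp x : f x <= p x.
  apply: le_trans (qp x) _.
  have := sublinear_push_le v ps x (lexx 0).
  by rewrite scale0r addr0 mul0r subr0.
have fN : f (- v) = - f v by exact: linearN.
exists f; split=> //; apply/eqP; rewrite eq_le fp/= -lerN2 -fN.
apply: le_trans (qp _) _.
have := sublinear_push_le v ps (- v) ler01.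
by rewrite scale1r mul1r addNr (sublinear0 ps) sub0r.
Qed.

End HahnBanach.

(** * Geometric series, subsequences and Cesaro means *)

Section Series.
Context {R : realType}.

Lemma geometric_half_sum_le (k m : nat) :
  \sum_(k <= j < m) (2^-1 : R) ^+ j <= 2 * 2^-1 ^+ k.
Proof.
have [km|mk] := leqP k m; last first.
  by rewrite big_geq ?(ltnW mk)// mulr_ge0.
suff -> : \sum_(k <= j < m) (2^-1 : R) ^+ j
    = 2 * 2^-1 ^+ k - 2 * 2^-1 ^+ m.
  by rewrite lerBlDr lerDl mulr_ge0.
elim: m km => [|m IH].
  by rewrite leqn0 => /eqP ->; rewrite big_geq// subrr.
rewrite leq_eqVlt => /predU1P[->|km]; first by rewrite big_geq// subrr.
by rewrite big_nat_recr//= IH// exprS; field.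
Qed.

Lemma double_exprn_half_cvg0 : 2 * (2^-1 : R) ^+ n @[n --> \oo] --> 0.
Proof.
rewrite (_ : (fun _ => _) = geometric 2 2^-1)//.
by apply: cvg_geometric; rewrite ger0_norm// invf_lt1// ltr1n.
Qed.

End Series.

(** Diagonal extraction: properties that hold eventually in the last index can
    be made to hold for all pairs of terms of a subsequence. *)
Lemma subseq_extraction (Q : nat -> nat -> nat -> Prop) :
  (forall k i, \forall n \near \oo, Q k i n) ->
  exists2 phi : nat -> nat, increasing_seq phi &
    forall k i, (i < k)%N -> Q k (phi i) (phi k).
Proof.
move=> Qn.
have step k m : exists n, (m < n)%N /\ forall i, (i <= m)%N -> Q k i n.
  have : \forall n \near \oo, (m < n)%N /\ forall i, (i <= m)%N -> Q k i n.
    apply: filterI; first exact: nbhs_infty_gt.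
    elim: m => [|m IH].
      by apply: filterS (Qn k 0) => n Q0 i; rewrite leqn0 => /eqP ->.
    apply: filterS2 IH (Qn k m.+1) => n Qm Qm1 i.
    by rewrite leq_eqVlt => /predU1P[->//|]; exact: Qm.
  by move=> /filter_ex.
have /choice[N NP] : forall km : nat * nat, exists n,
    (km.2 < n)%N /\ forall i, (i <= km.2)%N -> Q km.1 i n.
  by case=> k m; exact: step.
pose phi := fix phi k := if k is k'.+1 then N (k, phi k') else 0%N.
have phiS k : (phi k < phi k.+1)%N by have [] := NP (k.+1, phi k).
have phii : increasing_seq phi.
  by apply/increasing_seqP => n; rewrite ltEnat/= phiS.
exists phi => // -[//|k] i ik.
by have [_] := NP (k.+1, phi k); apply; have := phii i k; rewrite leEnat => ->.
Qed.

Lemma cvg_comp_increasing {T : topologicalType} (u : T ^nat)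
    (phi : nat -> nat) (l : T) :
  increasing_seq phi -> u @ \oo --> l -> (u \o phi) @ \oo --> l.
Proof.
move=> phii ul; apply: cvg_comp ul.
apply/cvgnyPge => A; exists A => // n /= An; apply: leq_trans An _.
elim: n => // n.
move/increasing_seqP : phii => /(_ n); rewrite ltEnat/= => + IH.
exact: leq_ltn_trans.
Qed.

Section Cesaro.
Context {R : realType} {V : normedModType R}.

Lemma cesaro_seqD (y z : V ^nat) :
  cesaro_seq (fun n => y n + z n) = (fun n => cesaro_seq y n + cesaro_seq z n).
Proof. by apply/funext => n; rewrite /cesaro_seq/= big_split scalerDr. Qed.

Lemma cesaro_seq_cvg0 (y : V ^nat) :
  y @ \oo --> (0 : V) -> cesaro_seq y @ \oo --> (0 : V).
Proof.
move=> /cvg_norm; rewrite normr0 => /cesaro y0.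
apply/norm_cvg0P; apply: squeeze_cvgr (cvg_cst 0) y0; near=> n.
rewrite normr_ge0/= /cesaro_seq /arithmetic_mean/= normrZ ger0_norm ?invr_ge0//.
by rewrite ler_wpM2l ?invr_ge0// seriesEord/= ler_norm_sum.
Unshelve. all: by end_near. Qed.

End Cesaro.

Lemma has_cesaro_cvg_subseq_perturb {R : realType} {V : completeNormedModType R}
    (y z : V ^nat) (phi : nat -> nat) :
  increasing_seq phi -> (fun n => y (phi n) - z n) @ \oo --> (0 : V) ->
  has_cesaro_cvg_subseq z -> has_cesaro_cvg_subseq y.
Proof.
move=> phii yz0 [psi psii zl]; exists (phi \o psi).
  by move=> m n /=; rewrite phii -leEnat psii.
have -> : y \o (phi \o psi) =
    (fun n => (y (phi (psi n)) - z (psi n)) + z (psi n)).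
  by apply/funext => n /=; rewrite subrK.
rewrite cesaro_seqD; apply: is_cvgD; last exact: zl.
apply: cvgP; apply: cesaro_seq_cvg0.
exact: (cvg_comp_increasing psii yz0).
Qed.

(** * Continuity of bounded operators *)

Lemma bounded_operator_continuous {R : realType} {V W : normedModType R}
    (f : {linear V -> W}) :
  bounded_operator f -> continuous f.
Proof.
move=> [C fC]; apply: bounded_linear_continuous; apply/linear_boundedP.
exists C; split; first exact: num_real.
by move=> r Cr x; apply: le_trans (fC x) _; rewrite ler_wpM2r// ltW.
Qed.

Lemma bounded_operator_cvg {R : realType} {V W : normedModType R}
    (f : {linear V -> W}) (I : Type) (F : set_system I) {FF : Filter F}
    (x : I -> V) (l : V) :
  bounded_operator f -> x @ F --> l -> f (x i) @[i --> F] --> f l.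
Proof.
move=> fb xl; apply: continuous_cvg => //; exact: bounded_operator_continuous.
Qed.

(** * Consequences of order continuity *)

Section OrderContinuity.
Context {R : realType} {E : banachLatticeType R}.
Implicit Types (x : E ^nat) (u v w : E).

Local Notation "x `&` y" := (Order.meet x y) : ring_scope.
Local Notation "x `|` y" := (Order.join x y) : ring_scope.
Local Notation abs := (@lattice_abs R E).

(** Banach lattices are Archimedean. *)
Lemma bl_archimedean_ge0 w u : 0 <= w -> (forall k : nat, w *+ k <= u) -> w = 0.
Proof.
move=> w0 wu; apply/eqP; rewrite -normr_eq0; apply/negPn/negP => w_neq0.
have w_gt0 : 0 < `|w| by rewrite lt_def w_neq0 normr_ge0.
have [k] : exists k : nat, `|u| / `|w| < k%:R.
  exists (Num.bound (`|u| / `|w|)).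
  by apply: archi_boundP; rewrite divr_ge0.
apply/negP; rewrite -leNgt ler_pdivlMr// mulrC mulr_natr -normrMn.
apply: bl_ler_norm => //.
by elim: k => [|k IH]; rewrite ?mulr0n ?mulrS// bl_addr_ge0.
Qed.

(** The gaps [y - x n], where [y] ranges over the upper bounds of an increasing
    sequence [x] bounded above, form a net decreasing to 0: if [w' >= 0] is
    below all gaps, then [y - w'] is again an upper bound of [x] whenever [y]
    is, so that all multiples of [w'] are below [u - x 0]. *)
Lemma increasing_gap_decreasing_to0 x u :
  nondecreasing_seq x -> (forall n, x n <= u) ->
  decreasing_to0
    (fun a b : {y : E | forall n, x n <= y} * nat =>
       sval b.1 <= sval a.1 /\ (a.2 <= b.2)%N)
    (fun a => sval a.1 - x a.2).
Proof.
move=> xnd xu; split.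
- split.
  + by split; exact: (exist _ u xu, 0%N).
  + by move=> a; split.
  + move=> a b c [ba ab] [cb bc].
    by split; [exact: le_trans cb ba|exact: leq_trans ab bc].
  + move=> [[y1 y1P] n1] [[y2 y2P] n2].
    have yP n : x n <= y1 `&` y2 by rewrite lexI y1P y2P.
    by exists (exist (fun y : E => forall n, x n <= y) _ yP, maxn n1 n2);
      split => /=; rewrite ?leIl ?leIr ?leq_maxl ?leq_maxr.
- move=> a b [ba ab]; apply: bl_lerD => //; rewrite bl_lerN2; exact: xnd.
- have lb0 : lbound (range (fun a : {y : E | forall n, x n <= y} * nat =>
      sval a.1 - x a.2)) 0.
    by move=> _ [[[y yP] n] _ <-] /=; rewrite bl_subr_ge0.
  split => // w wlb; pose w' := w `|` 0.
  have w'lb (y : E) n : (forall n, x n <= y) -> w' <= y - x n.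
    move=> yP; rewrite leUx bl_subr_ge0 yP andbT.
    by apply: wlb; exists (exist (fun y : E => forall n, x n <= y) y yP, n).
  have uk k n : x n <= u - w' *+ k.
    elim: k n => [|k IH] n; first by rewrite mulr0n subr0.
    by rewrite mulrSr opprD addrA bl_lerBrDr [leLHS]addrC -bl_lerBrDr w'lb.
  rewrite -(@bl_archimedean_ge0 w' (u - x 0%N)); first exact: leUl.
    exact: leUr.
  by move=> k; rewrite bl_lerBrDr [leLHS]addrC -bl_lerBrDr.
Qed.

Context (hE : order_continuous E).

Lemma order_continuous_small_term (J : Type) (r : J -> J -> Prop)
    (y : J -> E) (e : R) :
  decreasing_to0 r y -> 0 < e -> exists a, `|y a| < e.
Proof.
move=> ydec e0.
have [a _ ae] := hE ydec (nbhsx_ballx (0 : R) e e0).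
exists a; have [[_ rr _ _] _ _] := ydec.
by have := ae a (rr a); rewrite /= /ball/= sub0r normrN normr_id.
Qed.

(** Order continuity is stated for nets decreasing to 0 only. Norm convergence
    of every increasing sequence bounded above, without assuming that it has a
    supremum, follows from applying it to the net of gaps. *)
Lemma order_continuous_nondecreasing_cvg x u :
  nondecreasing_seq x -> (forall n, x n <= u) -> cvgn x.
Proof.
move=> xnd xu; apply/cauchy_cvgP; apply: cauchy_exP => e e0.
have [[[y yP] N] /= yN] :=
  order_continuous_small_term (increasing_gap_decreasing_to0 xnd xu) e0.
exists y; exists N => // n /= Nn.
rewrite -ball_normE/=; apply: le_lt_trans yN.
apply: bl_ler_norm; first by rewrite bl_subr_ge0.
by rewrite bl_lerD2l bl_lerN2; exact: xnd.
Qed.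

Lemma order_continuous_nonincreasing_cvg x u :
  nonincreasing_seq x -> (forall n, u <= x n) -> cvgn x.
Proof.
move=> xni ux; rewrite -is_cvgNE.
apply: (@order_continuous_nondecreasing_cvg _ (- u)).
  by move=> m n mn; rewrite bl_lerN2; exact: xni.
by move=> n; rewrite bl_lerN2.
Qed.

Lemma nonincreasing_cvg0_decreasing_to0 x :
  nonincreasing_seq x -> x @ \oo --> (0 : E) ->
  decreasing_to0 (fun m n => (m <= n)%N) x.
Proof.
move=> xni x0; split=> //.
- split.
  + by split; exact: 0%N.
  + by [].
  + by move=> a b c; exact: leq_trans.
  + by move=> a b; exists (maxn a b); rewrite ?leq_maxl ?leq_maxr.
- split.
  + move=> _ [n _ <-]; apply: (bl_closed_le _ x0).
    by exists n => // m /= nm; exact: xni.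
  + move=> w wlb; apply: (bl_closed_ge _ x0).
    by apply: nearW => n; apply: wlb; exists n.
Qed.

(** The sequence is dominated by the tails [l - s n], where [s] are its partial
    sums and [l] their limit. By disjointness the sums are suprema, hence
    bounded by [u]. *)
Lemma disjoint_bounded_order_cvg0 x u :
  (forall n, 0 <= x n) -> (forall n, x n <= u) ->
  (forall m n, m != n -> x m `&` x n = 0) -> order_cvg \oo x 0.
Proof.
move=> x0 xu xd; pose s n : E := \sum_(i < n) x i.
have s0 n : 0 <= s n by exact: bl_sumr_ge0.
have sd n m : (n <= m)%N -> s n `&` x m = 0.
  elim: n => [_|n IH nm].
    by rewrite /s big_ord0; apply/eqP; rewrite eq_le leIl lexI lexx x0.
  apply/eqP; rewrite eq_le; apply/andP; split; last by rewrite lexI s0 x0.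
  rewrite /s big_ord_recr/= -/(s n).
  apply: le_trans (bl_meetDl (s0 n) (x0 n) (x0 m)) _.
  by rewrite IH ?(ltnW nm)// xd ?addr0// neq_ltn nm.
have su n : s n <= u.
  elim: n => [|n IH].
    by rewrite /s big_ord0; exact: le_trans (x0 0%N) (xu 0%N).
  by rewrite /s big_ord_recr/=; apply: bl_meetI0D_le => //; exact: sd.
have snd : nondecreasing_seq s.
  apply/nondecreasing_seqP => n.
  by rewrite /s big_ord_recr/= bl_lerDl.
have /cvg_ex[/= l sl] := order_continuous_nondecreasing_cvg snd su.
exists nat, (fun m n => (m <= n)%N), (fun n => l - s n); split.
  apply: nonincreasing_cvg0_decreasing_to0.
    by move=> m n mn; rewrite bl_lerD2l bl_lerN2; exact: snd.
  by rewrite -(subrr l); apply: cvgB => //; exact: cvg_cst.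
move=> b; exists b => // n /= bn.
rewrite subr0 ge0_lattice_abs// bl_lerBrDr [leLHS]addrC.
apply: (@le_trans _ _ (s n.+1)).
  by rewrite /s big_ord_recr/= -/(s n) bl_lerD2r; exact: snd.
apply: (bl_closed_ge _ sl); exists n.+1 => // m /= nm; exact: snd.
Qed.

Lemma disjoint_seq_uo_cvg0 x : disjoint_seq x -> uo_cvg \oo x 0.
Proof.
move=> xd u u0; apply: disjoint_bounded_order_cvg0.
- by move=> n; rewrite lexI lattice_abs_ge0.
- by move=> n; exact: leIr.
- move=> m n mn; rewrite !subr0; apply/eqP; rewrite eq_le; apply/andP; split.
    by rewrite -(xd _ _ mn) leI2 ?leIl.
  by rewrite !lexI !lattice_abs_ge0 u0.
Qed.

Lemma uo_cvg_un_cvg (I : Type) (F : set_system I) (FF : Filter F)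
    (x : I -> E) l :
  uo_cvg F x l -> un_cvg F x l.
Proof.
move=> xl u u0; have [J [r [y [ydec yF]]]] := xl u u0.
apply/cvgr0Pnorm_lt => e e0.
have [a ya] := order_continuous_small_term ydec e0.
apply: filterS (yF a) => i; rewrite subr0 => xy; apply: le_lt_trans ya.
exact: lattice_abs_ler_norm.
Qed.

End OrderContinuity.

(** * Disjoint approximation of un-null sequences *)

Section AlmostDisjoint.
Context {R : realType} {E : banachLatticeType R}.
Implicit Types (x : E ^nat) (u v w : E).

Local Notation "x `&` y" := (Order.meet x y) : ring_scope.
Local Notation "x `|` y" := (Order.join x y) : ring_scope.
Local Notation abs := (@lattice_abs R E).

(** The truncation of [w] to the order interval [[- v, v]], for [v >= 0]. *)
Definition lattice_clamp v w : E := (w `&` v) `|` - v.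

Lemma lattice_abs_clamp v w : 0 <= v -> abs (lattice_clamp v w) <= v.
Proof.
move=> v0; rewrite lattice_abs_le -[X in _ && (_ <= X)]opprK bl_lerN2 leUr.
by rewrite andbT leUx leIr (le_trans _ v0)// bl_oppr_le0.
Qed.

Lemma lattice_abs_subr_clamp v w : 0 <= v ->
  abs (w - lattice_clamp v w) <= (abs w - v) `|` 0.
Proof.
move=> v0; set m := (abs w - v) `|` 0.
have m0 : 0 <= m by exact: leUr.
have vm : abs w <= m + v by rewrite -bl_lerBlDr; exact: leUl.
rewrite lattice_abs_le; apply/andP; split.
  rewrite bl_lerBlDr [leRHS]addrC -bl_lerBlDr.
  apply: (@le_trans _ _ (w `&` v)); last exact: leUl.
  rewrite lexI !bl_lerBlDr bl_lerDl//= [leRHS]addrC.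
  exact: le_trans (lattice_abs_ler w) vm.
rewrite opprB bl_lerBlDr leUx; apply/andP; split.
  by apply: (@le_trans _ _ w); [exact: leIl|rewrite [leRHS]addrC bl_lerDl].
rewrite -bl_lerBlDr [leLHS]addrC bl_lerBlDr.
exact: le_trans (lattice_abs_lerN w) vm.
Qed.

(** A positive sequence with geometrically decreasing norms is dominated by its
    norm convergent sum. *)
Lemma bl_dominating_sum x (c : R) :
  (forall i, 0 <= x i) -> (forall i, `|x i| <= c * 2^-1 ^+ i) ->
  exists v, (forall i, x i <= v) /\ `|v| <= 2 * c.
Proof.
move=> x0 xc.
have c0 : 0 <= c by have := xc 0%N; rewrite expr0 mulr1; exact: le_trans.
have bnd n : \sum_(0 <= i < n) `|x i| <= 2 * c.
  apply: (@le_trans _ _ (\sum_(0 <= i < n) c * 2^-1 ^+ i)).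
    exact: ler_sum.
  rewrite -mulr_sumr mulrC ler_wpM2r//.
  by have := geometric_half_sum_le (R := R) 0 n; rewrite expr0 mulr1.
have cx : cvgn (series x).
  apply: normed_cvg; apply: nondecreasing_is_cvgn.
    by apply: nondecreasing_series => // n _ _; exact: normr_ge0.
  by exists (2 * c) => _ [n _ <-]; exact: bnd.
exists (limn (series x)); split.
  move=> i; apply: (bl_closed_ge _ cx); exists i.+1 => // n /= ni.
  rewrite /series/= (big_cat_nat _ (n := i.+1))//= big_nat_recr//=.
  rewrite [in leRHS]addrAC [leRHS]addrC.
  by apply: bl_lerDl; rewrite bl_addr_ge0// bl_sumr_ge0.
rewrite -lim_norm//; apply: limr_le; first exact: is_cvg_norm.
by apply: nearW => n; apply: le_trans (bnd n); rewrite ler_norm_sum.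
Qed.

(** Kadec-Pelczynski disjointification. With [y k = |x (phi k)|] and [v k]
    above all overlaps [y k /\ y i], [i != k], the truncated terms satisfy
    [|d k| <= (y k - v k)^+ <= y k - y k /\ y i], which makes them disjoint. *)
Theorem un_cvg0_almost_disjoint x : un_cvg \oo x 0 ->
  exists phi : nat -> nat, exists d : E ^nat,
    [/\ increasing_seq phi, disjoint_seq d &
        x (phi n) - d n @[n --> \oo] --> (0 : E)].
Proof.
move=> xun.
(* The exponent [k + k] bounds the overlap of terms [i] and [k] by
   [2^-i 2^-k], which sums over [i] to a multiple of [2^-k]. *)
pose Q k i n := `|abs (x n) `&` abs (x i)| <= (2^-1 : R) ^+ (k + k).
have Qn k i : \forall n \near \oo, Q k i n.
  have /cvgr0Pnorm_le/(_ ((2^-1 : R) ^+ (k + k))) :=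
    xun (abs (x i)) (lattice_abs_ge0 _).
  rewrite exprn_gt0// => /(_ isT); apply: filterS => n.
  by rewrite subr0.
have [phi phii Qphi] := subseq_extraction Qn.
pose y k := abs (x (phi k)).
have y0 k : 0 <= y k by exact: lattice_abs_ge0.
pose w k i : E := if i == k then 0 else y k `&` y i.
have /choice[v vP] : forall k, exists v,
    (forall i, w k i <= v) /\ `|v| <= 2 * (2^-1 : R) ^+ k.
  move=> k; apply: bl_dominating_sum => i; rewrite /w.
    by case: eqP => // _; rewrite lexI !y0.
  have le2 m n p : (m + n <= p)%N -> (2^-1 : R) ^+ p <= 2^-1 ^+ m * 2^-1 ^+ n.
    by move=> mnp; rewrite -exprD ler_wiXn2l// invf_le1// ler1n.
  case: ltngtP => [ik|ki|_]; last by rewrite normr0 mulr_ge0.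
    by apply: le_trans (Qphi _ _ ik) (le2 _ _ _ _); rewrite leq_add2l ltnW.
  rewrite meetC; apply: le_trans (Qphi _ _ ki) (le2 _ _ _ _).
    by rewrite leq_add2r ltnW.
have v0 k : 0 <= v k by have := (vP k).1 k; rewrite /w eqxx.
pose d k := x (phi k) - lattice_clamp (v k) (x (phi k)).
exists phi, d; split=> //.
- move=> k m km; apply/eqP; rewrite eq_le lexI !lattice_abs_ge0 !andbT.
  pose u := y k `&` y m.
  have du i j : i != j -> u = y i `&` y j -> abs (d i) <= y i - u.
    move=> ij uE; apply: le_trans (lattice_abs_subr_clamp _ (v0 i)) _.
    rewrite leUx bl_lerD2l bl_lerN2 bl_subr_ge0 uE leIl andbT.
    by have := (vP i).1 j; rewrite /w eq_sym (negbTE ij).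
  apply: (@le_trans _ _ ((y k - u) `&` (y m - u))).
    by rewrite leI2// (du _ _ km, du m k)// 1?eq_sym// meetC.
  by rewrite -bl_meetD subrr.
- apply/norm_cvg0P.
  apply: (@squeeze_cvgr _ _ _ _ (fun=> 0) (fun n => 2 * (2^-1 : R) ^+ n)).
  + apply: nearW => n; rewrite normr_ge0/= /d subKr.
    apply: le_trans (vP n).2; apply: lattice_abs_ler_norm.
    exact: lattice_abs_clamp.
  + exact: cvg_cst.
  + exact: double_exprn_half_cvg0.
Qed.

End AlmostDisjoint.

(** * Order bounded weakly null sequences *)

Section PositiveFunctionals.
Context {R : realType} {E : banachLatticeType R}.
Implicit Types (x y u v w : E).

Local Notation "x `&` y" := (Order.meet x y) : ring_scope.
Local Notation "x `|` y" := (Order.join x y) : ring_scope.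
Local Notation abs := (@lattice_abs R E).

Lemma sublinear_norm_pospart : sublinear (fun x : E => `|x `|` 0|).
Proof.
split=> [x y|a x a0].
  apply: le_trans (ler_normD _ _); apply: bl_ler_norm; first exact: leUr.
  by rewrite leUx bl_lerD ?leUl// bl_addr_ge0// leUr.
rewrite -[a in leRHS]gtr0_norm// -normrZ; apply: bl_ler_norm; first exact: leUr.
rewrite leUx -[X in _ && (X <= _)](scaler0 _ a).
by apply/andP; split; apply: bl_lerZ; rewrite ?(ltW a0)// ?leUl ?leUr.
Qed.

(** Domination by [x |-> ||x^+||] forces positivity of [f], since it gives
    [f (- x) <= 0] for [x >= 0]. *)
Lemma positive_norming_functional v : 0 <= v ->
  exists f : {linear E -> R^o},
    [/\ forall x, 0 <= x -> 0 <= f x, forall x, `|f x| <= `|x| & f v = `|v|].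
Proof.
move=> v0; have [f [fp fv]] := hahn_banach_sublinear v sublinear_norm_pospart.
have fN x : - f x <= `|(- x) `|` 0| by rewrite -linearN; exact: fp.
exists f; split.
- move=> x x0; rewrite -oppr_le0; apply: le_trans (fN x) _.
  by rewrite join_r ?normr0// bl_oppr_le0.
- move=> x; rewrite ler_norml lerNl (le_trans (fN x))/=; last first.
    by rewrite -[leRHS]normrN norm_pospart.
  exact: le_trans (fp x) (norm_pospart x).
- by rewrite fv join_l.
Qed.

Lemma positive_functional_ler (f : {linear E -> R^o}) x y :
  (forall z, 0 <= z -> 0 <= f z) -> x <= y -> f x <= f y.
Proof.
by move=> f0 xy; rewrite -subr_ge0 -linearB; apply: f0; rewrite bl_subr_ge0.
Qed.

Lemma contractive_functional_bounded (f : {linear E -> R^o}) :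
  (forall x, `|f x| <= `|x|) -> bounded_operator f.
Proof. by move=> f1; exists 1 => x; rewrite mul1r. Qed.

Context (hE : order_continuous E).

Lemma order_bounded_weakly_null_small (y : E ^nat) u (e : R) :
  (forall n, 0 <= y n) -> (forall n, y n <= u) -> weak_cvg \oo y 0 -> 0 < e ->
  exists n, `|y n| < e.
Proof.
move=> y0 yu yw e0; apply: contrapT => /forallNP/= ye.
have {}ye n : e <= `|y n| by rewrite leNgt; apply/negP/ye.
have /choice[f fP] : forall n, exists f : {linear E -> R^o},
    [/\ forall x, 0 <= x -> 0 <= f x, forall x, `|f x| <= `|x|
      & f (y n) = `|y n|].
  by move=> n; exact: positive_norming_functional.
have fb n : bounded_operator (f n).
  by apply: contractive_functional_bounded; have [] := fP n.
have Qn k i : \forall n \near \oo, f i (y n) <= (2^-1 : R) ^+ k.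
  have := yw (f i) (fb i).
  rewrite linear0 => /cvgr0Pnorm_le/(_ ((2^-1 : R) ^+ k)).
  rewrite exprn_gt0// => /(_ isT); apply: filterS => n.
  exact: le_trans (ler_norm _).
have [phi _ Qphi] := subseq_extraction Qn.
pose Y k := y (phi k); pose g k := f (phi k).
have g0 k x : 0 <= x -> 0 <= g k x by have [+ _ _] := fP (phi k); exact.
have gle k x x' : x <= x' -> g k x <= g k x'.
  exact: positive_functional_ler (g0 k).
have Y0 k : 0 <= Y k by exact: y0.
have u0 : 0 <= u by exact: le_trans (y0 0%N) (yu 0%N).
(* [z k] is the supremum of the truncated sums [s k m] over [m], and [t] the
   infimum of the [z k]; every [g i] vanishes at [t]. *)
pose s k m : E := (\sum_(k <= j < m) Y j) `&` u.
have snd k : nondecreasing_seq (s k).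
  apply/nondecreasing_seqP => m; rewrite /s leI2//.
  have [km|mk] := leqP k m; first by rewrite big_nat_recr//= bl_lerDl.
  by rewrite !big_geq// ltnW.
have su k m : s k m <= u by exact: leIr.
have zex k : exists z : E, s k @ \oo --> z.
  apply/cvg_ex.
  exact: (order_continuous_nondecreasing_cvg hE (snd k) (su k)).
have [z sz] := choice zex.
have sle k m : s k m <= z k.
  by apply: (bl_closed_ge _ (sz k)); exists m => // n /= mn; exact: snd.
have zni : nonincreasing_seq z.
  apply/nonincreasing_seqP => k; apply: (bl_closed_le _ (sz k.+1)).
  apply: nearW => m; apply: le_trans (sle k m); rewrite /s leI2//.
  have [km|mk] := ltnP k m; last by rewrite !big_geq// leqW.
  by rewrite [leRHS]big_ltn// [leRHS]addrC bl_lerDl.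
have z0 k : 0 <= z k.
  by apply: le_trans (sle k k); rewrite lexI u0 big_geq// lexx.
have /cvg_ex[/= t zt] := order_continuous_nonincreasing_cvg hE zni z0.
have tz k : t <= z k.
  by apply: (bl_closed_le _ zt); exists k => // n /= kn; exact: zni.
have Yz k : Y k <= z k.
  by apply: le_trans (sle k k.+1); rewrite lexI big_nat1 lexx yu.
have gz i k : (i < k)%N -> g i (z k) <= 2 * 2^-1 ^+ k.
  move=> ik.
  have gs : g i (s k m) @[m --> \oo] --> g i (z k).
    exact: bounded_operator_cvg (fb _) (sz k).
  rewrite -(cvg_lim _ gs)//; apply: limr_le; first exact: cvgP gs.
  apply: nearW => m; apply: le_trans (geometric_half_sum_le k m).
  apply: le_trans (gle _ _ _ (leIl _ _)) _.
  rewrite linear_sum/= !big_nat; apply: ler_sum => j /andP[kj _].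
  by apply: Qphi; exact: leq_trans ik kj.
have gt i : g i t <= 0.
  have h0 := @double_exprn_half_cvg0 R.
  rewrite -(cvg_lim _ h0)//; apply: limr_ge; first exact: cvgP h0.
  exists i.+1 => // k /= ik; exact: le_trans (gle _ _ _ (tz k)) (gz _ _ ik).
have /cvgrPdist_lt/(_ _ e0)[k _ /(_ k (leqnn k))/=] := zt.
apply/negP; rewrite -leNgt.
apply: le_trans (ye (phi k)) _; have [_ g1 <-] := fP (phi k).
apply: le_trans (gle k _ _ (Yz k)) _; rewrite distrC.
apply: le_trans (g1 _); apply: le_trans (ler_norm _).
by rewrite -/(g k) linearB lerBrDr gerDl.
Qed.

Theorem order_bounded_weakly_null_cvg0 (y : E ^nat) u :
  (forall n, 0 <= y n) -> (forall n, y n <= u) -> weak_cvg \oo y 0 ->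
  y @ \oo --> (0 : E).
Proof.
move=> y0 yu yw; apply/cvgr0Pnorm_lt => e e0; apply: contrapT => notnear.
have /choice[psi psiP] : forall N, exists n, (N <= n)%N /\ e <= `|y n|.
  move=> N; apply: contrapT => H; apply: notnear; exists N => // n /= Nn.
  by rewrite ltNge; apply/negP => yn; apply: H; exists n.
have [] := @order_bounded_weakly_null_small (y \o psi) u e _ _ _ e0.
- by move=> n; exact: y0.
- by move=> n; exact: yu.
- move=> f fb; apply: cvg_comp (yw f fb).
  apply/cvgnyPge => A; exists A => // n /= An.
  exact: leq_trans An (psiP n).1.
- by move=> n /=; rewrite ltNge (psiP n).2.
Qed.

Lemma uaw_cvg_un_cvg (x : E ^nat) l : uaw_cvg \oo x l -> un_cvg \oo x l.
Proof.
move=> xl u u0; apply: (@order_bounded_weakly_null_cvg0 _ u) (xl u u0).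
- by move=> n; rewrite lexI lattice_abs_ge0.
- by move=> n; exact: leIr.
Qed.

End PositiveFunctionals.

Lemma un_cvg_uaw_cvg {R : realType} {E : banachLatticeType R} (I : Type)
    (F : set_system I) (FF : Filter F) (x : I -> E) l :
  un_cvg F x l -> uaw_cvg F x l.
Proof.
move=> xl u u0 f fb.
exact: bounded_operator_cvg fb (xl u u0).
Qed.

(** * The equivalence *)

Theorem proposition3p10 (R : realType) (E : banachLatticeType R)
    (Y : completeNormedModType R) (hE : order_continuous E)
    (T : {linear E -> Y}) (hT : bounded_operator T) :
  [<-> disjoint_weak_Banach_Saks T ;
       forall x : E ^nat, weak_cvg \oo x 0 -> un_cvg \oo x 0 ->
         has_cesaro_cvg_subseq (T \o x) ;
       forall x : E ^nat, weak_cvg \oo x 0 -> uaw_cvg \oo x 0 ->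
         has_cesaro_cvg_subseq (T \o x) ;
       forall x : E ^nat, weak_cvg \oo x 0 -> uo_cvg \oo x 0 ->
         has_cesaro_cvg_subseq (T \o x)].
Proof.
tfae.
- move=> TBS x xw /un_cvg0_almost_disjoint[phi [d [phii dd xd]]].
  have dw : weak_cvg \oo d 0.
    move=> f fb; rewrite linear0.
    have -> : (fun n => f (d n)) =
        (fun n => f (x (phi n)) - f (x (phi n) - d n)).
      by apply/funext => n; rewrite linearB subKr.
    rewrite -[X in _ --> X](subr0 0) -{1}(linear0 f) -(linear0 f); apply: cvgB.
      exact: cvg_comp_increasing phii (xw f fb).
    exact: bounded_operator_cvg fb xd.
  apply: (has_cesaro_cvg_subseq_perturb phii _ (TBS d dd dw)).
  have -> : (fun n => (T \o x) (phi n) - (T \o d) n) =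
      (fun n => T (x (phi n) - d n)).
    by apply/funext => n; rewrite linearB.
  rewrite -(linear0 T); exact: bounded_operator_cvg xd.
- by move=> h x xw xuaw; apply: h => //; exact: uaw_cvg_un_cvg.
- move=> h x xw xuo; apply: h => //.
  by apply: un_cvg_uaw_cvg; exact: uo_cvg_un_cvg.
- by move=> h x xd xw; apply: h => //; exact: disjoint_seq_uo_cvg0.
Qed.
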